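(* Let $p$ be an odd prime, $n\ge1$ an integer, $r\in\mathbb{Z}_{>0}\cup\{\infty\}$, and let \[G_{n,r}=\langle x_1,y_1,\dots,x_n,y_n\mid x_1^{p^r}[x_1,y_1]\cdots[x_n,y_n]\rangle\] be the Demushkin (pro-$p$) group with $2n$ generators and orientability level $r$. Let $\Gamma$ be a finite $p$-group. Then \[ |\mathrm{Hom}(G_{n,r},\Gamma)|=|\Gamma|^{2n-2}\sum_{\rho\in\mathrm{Irr}(\Gamma)}\frac{1}{\dim(\rho)^{2n-2}}\sum_{g\in\Gamma}\chi_\rho(g^{p^r-1})\chi_\rho(g). \]
   Context: The presentation is as a pro-$p$ group (quotient of the free pro-$p$ group on $x_1,\dots,y_n$ by the closed normal subgroup generated by the relator). $\mathrm{Hom}$ denotes continuous group homomorphisms. $\mathrm{Irr}(\Gamma)$ is the set of isomorphism classes of irreducible finite-dimensional complex representations of $\Gamma$, and $\chi_\rho$ is the character of $\rho$. Convention for $r=\infty$: $p^\infty=0$, so the relator is $[x_1,y_1]\cdots[x_n,y_n]$ and $g^{p^r-1}=g^{-1}$. *)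

(* Defs.v *)
From HB Require Import structures.
From mathcomp Require Import all_boot all_order all_algebra.
From mathcomp Require Import all_fingroup all_solvable all_field all_character.
From mathcomp Require Import generic_quotient finmap.
From mathcomp Require Import boolp classical_sets functions cardinality.
From mathcomp Require Import topology.

Set Implicit Arguments.
Unset Strict Implicit.
Unset Printing Implicit Defensive.

Local Open Scope classical_set_scope.
Local Open Scope group_scope.
Local Open Scope quotient_scope.

(* A letter (x, false) stands for x and (x, true) for its inverse. *)
Definition inv_letter (X : Type) (a : X * bool) : X * bool := (a.1, ~~ a.2).

Definition reduced (X : eqType) (w : seq (X * bool)) : bool :=
  sorted (fun a b => b != inv_letter a) w.

Definition push (X : eqType) (a : X * bool) (w : seq (X * bool)) :=
  if w is b :: w' then if b == inv_letter a then w' else a :: w else [:: a].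

Section Reduced.
Variable X : eqType.
Implicit Types (a b : X * bool) (u v w : seq (X * bool)).

Lemma inv_letterK : involutive (@inv_letter X).
Proof. by case=> x b; rewrite /inv_letter /= negbK. Qed.

Lemma push_reduced a w : reduced w -> reduced (push a w).
Proof.
case: w => [|b w] //=; case: ifPn => [_|nab] rw; last by rewrite /reduced /= nab.
by move: rw; rewrite /reduced; case: w => //= c w /andP[].
Qed.

Lemma pushK a w : reduced w -> push a (push (inv_letter a) w) = w.
Proof.
case: w => [|b w] /=; first by rewrite eqxx.
rewrite inv_letterK; case: eqVneq => [->|_ _]; last by rewrite /= eqxx.
by case: w => [|c w] //=; rewrite /reduced /= => /andP[/negPf->].
Qed.

Lemma foldr_push_reduced v u : reduced v -> reduced (foldr (@push X) v u).
Proof. by move=> rv; elim: u => //= a u; exact: push_reduced. Qed.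

Lemma foldr_push a u w :
  reduced w -> foldr (@push X) w (push a u) = push a (foldr (@push X) w u).
Proof.
case: u => [|b u] //= rw; case: eqP => //= ->.
by rewrite pushK // foldr_push_reduced.
Qed.

Lemma foldr_pushA u v w : reduced w ->
  foldr (@push X) w (foldr (@push X) v u) =
  foldr (@push X) (foldr (@push X) w v) u.
Proof. by move=> rw; elim: u => //= a u IHu; rewrite foldr_push // IHu. Qed.

Lemma foldr_push_nil u : reduced u -> foldr (@push X) [::] u = u.
Proof.
elim: u => //= a u IHu ru; rewrite IHu; last exact: path_sorted ru.
by case: u ru {IHu} => //= b u; rewrite /reduced /= => /andP[/negPf->].
Qed.

Definition inv_word w := rev (map (@inv_letter X) w).

Lemma inv_word_reduced w : reduced w -> reduced (inv_word w).
Proof.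
rewrite /reduced /inv_word rev_sorted sorted_map; apply: sub_sorted => a b /=.
rewrite /relpre /= => nab; apply: contra nab => /eqP e.
by rewrite e inv_letterK.
Qed.

Lemma inv_wordK : involutive inv_word.
Proof.
by move=> w; rewrite /inv_word map_rev revK -map_comp map_id_in // => a _;
  exact: inv_letterK.
Qed.

Lemma foldr_push_inv w : reduced w -> foldr (@push X) w (inv_word w) = [::].
Proof.
elim: w => //= a w IHw rw; rewrite /inv_word map_cons rev_cons foldr_rcons /=.
by rewrite inv_letterK eqxx; apply/IHw/(path_sorted rw).
Qed.
End Reduced.

(* The free group on X, realized as the reduced words; push multiplies a      *)
(* reduced word by a letter on the left.                                      *)
Record free_group (X : choiceType) :=
  FreeGroup { word : seq (X * bool); _ : reduced word }.

Section FreeGroup.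
Variable X : choiceType.
HB.instance Definition _ := [isSub for @word X].
HB.instance Definition _ := [Choice of free_group X by <:].

Definition fg_one : free_group X := @FreeGroup X [::] isT.
Definition fg_inv (u : free_group X) : free_group X :=
  FreeGroup (inv_word_reduced (valP u)).
Definition fg_mul (u v : free_group X) : free_group X :=
  FreeGroup (foldr_push_reduced (word u) (valP v)).

Lemma fg_mulA : associative fg_mul.
Proof. by move=> u v w; apply/val_inj; rewrite /= foldr_pushA // (valP w). Qed.
Lemma fg_mul1 : left_id fg_one fg_mul.
Proof. by move=> u; apply/val_inj. Qed.
Lemma fg_mulr1 : right_id fg_one fg_mul.
Proof. by move=> u; apply/val_inj; rewrite /= foldr_push_nil // (valP u). Qed.
Lemma fg_mulV : left_inverse fg_one fg_inv fg_mul.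
Proof. by move=> u; apply/val_inj; rewrite /= foldr_push_inv // (valP u). Qed.
Lemma fg_mulVr : right_inverse fg_one fg_inv fg_mul.
Proof.
move=> u; apply/val_inj.
by have := foldr_push_inv (inv_word_reduced (valP u)); rewrite inv_wordK.
Qed.

HB.instance Definition _ := isGroup.Build (free_group X)
  fg_mulA fg_mul1 fg_mulr1 fg_mulV fg_mulVr.

Definition fg_gen (x : X) : free_group X := @FreeGroup X [:: (x, false)] isT.
End FreeGroup.

Record normal_subgroup (G : groupType) := NormalSubgroup {
  ns_set :> set G;
  ns1 : ns_set 1;
  nsM : forall x y, ns_set x -> ns_set y -> ns_set (x * y);
  nsV : forall x, ns_set x -> ns_set x^-1;
  nsJ : forall x y, ns_set x -> ns_set (x ^ y) }.

Section QuotientGroup.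
Variables (G : groupType) (N : normal_subgroup G).

Definition coset_rel : rel G := fun x y => `[< ns_set N (x^-1 * y) >].

Lemma coset_rel_equiv : equiv_class_of coset_rel.
Proof.
rewrite /coset_rel; split=> [x|x y|y x z].
- by apply/asboolP; rewrite mulVg; exact: ns1.
- by apply: asbool_equiv_eq; split=> /nsV; rewrite invgM invgK.
- move=> /asboolP xy /asboolP yz; apply/asboolP.
  by rewrite -(mulgK y x^-1) -mulgA; apply: nsM.
Qed.

Canonical coset_equivRel := EquivRelPack coset_rel_equiv.

Definition quotg := {eq_quot coset_equivRel}.
HB.instance Definition _ := Quotient.on quotg.
HB.instance Definition _ := Choice.on quotg.

Lemma quotgP (x y : G) : \pi_quotg x = \pi_quotg y <-> ns_set N (x^-1 * y).
Proof. by split=> [/eqmodP/asboolP|Nxy]; last exact/eqmodP/asboolP. Qed.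

Definition quotg_one : quotg := \pi_quotg 1.
Definition quotg_inv (a : quotg) : quotg := \pi_quotg (repr a)^-1.
Definition quotg_mul (a b : quotg) : quotg := \pi_quotg (repr a * repr b).

Lemma quotg_mul_pi x y : quotg_mul (\pi_quotg x) (\pi_quotg y) = \pi_quotg (x * y).
Proof.
apply/quotgP; set x' := repr _; set y' := repr _.
have /quotgP Nx : \pi_quotg x' = \pi_quotg x by rewrite reprK.
have /quotgP Ny : \pi_quotg y' = \pi_quotg y by rewrite reprK.
suff -> : (x' * y')^-1 * (x * y) = (x'^-1 * x) ^ y' * (y'^-1 * y).
  by apply: nsM => //; exact: nsJ.
by rewrite /conjg invgM !mulgA mulgK.
Qed.

Lemma quotg_inv_pi x : quotg_inv (\pi_quotg x) = \pi_quotg x^-1.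
Proof.
apply/quotgP; set x' := repr _.
have /quotgP/nsV Nx : \pi_quotg x' = \pi_quotg x by rewrite reprK.
have := nsJ x'^-1 Nx; rewrite /conjg !invgM !invgK.
by rewrite -mulgA mulgV mulg1.
Qed.

Lemma quotg_mulA : associative quotg_mul.
Proof.
by move=> a b c; elim/quotW: a => x; elim/quotW: b => y; elim/quotW: c => z;
  rewrite (quotg_mul_pi y z) (quotg_mul_pi x y) !quotg_mul_pi mulgA.
Qed.
Lemma quotg_mul1 : left_id quotg_one quotg_mul.
Proof. by move=> a; elim/quotW: a => x; rewrite quotg_mul_pi mul1g. Qed.
Lemma quotg_mulr1 : right_id quotg_one quotg_mul.
Proof. by move=> a; elim/quotW: a => x; rewrite quotg_mul_pi mulg1. Qed.
Lemma quotg_mulV : left_inverse quotg_one quotg_inv quotg_mul.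
Proof. by move=> a; elim/quotW: a => x; rewrite quotg_inv_pi quotg_mul_pi mulVg. Qed.
Lemma quotg_mulVr : right_inverse quotg_one quotg_inv quotg_mul.
Proof. by move=> a; elim/quotW: a => x; rewrite quotg_inv_pi quotg_mul_pi mulgV. Qed.

HB.instance Definition _ := isGroup.Build quotg
  quotg_mulA quotg_mul1 quotg_mulr1 quotg_mulV quotg_mulVr.
End QuotientGroup.

HB.mixin Record isTopologicalGroup G of monoid.Group G & Topological G := {
  mulg_continuous : continuous (fun xy : G * G => xy.1 * xy.2);
  invg_continuous : continuous (fun x : G => x^-1)
}.

#[short(type="topologicalGroupType")]
HB.structure Definition TopologicalGroup :=
  {G of isTopologicalGroup G & monoid.Group G & Topological G}.

Section ProPCompletion.
Variables (p : nat) (G : groupType).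

Record pnormal := PNormal {
  pn_ns :> normal_subgroup G;
  pnP : exists k : nat, ([set: quotg pn_ns] #= `I_(p ^ k)%N)%card }.

(* The canonical projection G/N -> G/M when N is contained in M. *)
Definition quotg_proj (N M : normal_subgroup G) (a : quotg N) : quotg M :=
  \pi_(quotg M) (repr a).

Definition coherent :
    set (prod_topology (fun N : pnormal => discrete_topology (quotg N))) :=
  [set w | forall N M : pnormal, N `<=` M -> quotg_proj M (w N) = w M].

(* The inverse limit of the G/N, with the topology induced by the product of  *)
(* the discrete topologies.                                                   *)
Definition pro_p_completion := set_type coherent.
HB.instance Definition _ := Topological.on pro_p_completion.

Lemma quotg_proj_pi (N M : normal_subgroup G) x :
  N `<=` M -> quotg_proj M (\pi_(quotg N) x) = \pi_(quotg M) x.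
Proof.
move=> NM; apply/quotgP/NM; set x' := repr _.
by apply/quotgP; rewrite reprK.
Qed.

Lemma quotg_projM (N M : normal_subgroup G) (a b : quotg N) : N `<=` M ->
  quotg_proj M (a * b) = quotg_proj M a * quotg_proj M b.
Proof.
move=> NM; elim/quotW: a => x; elim/quotW: b => y.
by rewrite [_ * _]quotg_mul_pi !quotg_proj_pi // [RHS]quotg_mul_pi.
Qed.

Lemma quotg_projV (N M : normal_subgroup G) (a : quotg N) : N `<=` M ->
  quotg_proj M a^-1 = (quotg_proj M a)^-1.
Proof.
move=> NM; elim/quotW: a => x.
by rewrite [_^-1]quotg_inv_pi !quotg_proj_pi // [RHS]quotg_inv_pi.
Qed.

Definition ppc_at (w : pro_p_completion) (N : pnormal) : quotg N := val w N.

Lemma ppc_of_subproof (g : G) : coherent (fun N => \pi_(quotg N) g).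
Proof. by move=> N M NM; rewrite quotg_proj_pi. Qed.

Lemma ppc_inv_subproof (w : pro_p_completion) :
  coherent (fun N => (ppc_at w N)^-1).
Proof.
move=> N M NM; rewrite quotg_projV //; congr (_^-1).
exact: (set_mem (valP w)).
Qed.

Lemma ppc_mul_subproof (u v : pro_p_completion) :
  coherent (fun N => ppc_at u N * ppc_at v N).
Proof.
move=> N M NM; rewrite quotg_projM //; congr (_ * _).
  exact: (set_mem (valP u)).
exact: (set_mem (valP v)).
Qed.

Definition ppc_of (g : G) : pro_p_completion :=
  exist (fun w => w \in coherent) _ (mem_set (ppc_of_subproof g)).
Definition ppc_inv (w : pro_p_completion) : pro_p_completion :=
  exist (fun w => w \in coherent) _ (mem_set (ppc_inv_subproof w)).
Definition ppc_mul (u v : pro_p_completion) : pro_p_completion :=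
  exist (fun w => w \in coherent) _ (mem_set (ppc_mul_subproof u v)).

Lemma ppcP (u v : pro_p_completion) :
  (forall N, ppc_at u N = ppc_at v N) -> u = v.
Proof. by move=> uv; apply/val_inj/functional_extensionality_dep. Qed.

Lemma ppc_mulA : associative ppc_mul.
Proof. by move=> u v w; apply/ppcP => N; exact: mulgA. Qed.
Lemma ppc_mul1 : left_id (ppc_of 1) ppc_mul.
Proof. by move=> u; apply/ppcP => N; exact: mul1g. Qed.
Lemma ppc_mulr1 : right_id (ppc_of 1) ppc_mul.
Proof. by move=> u; apply/ppcP => N; exact: mulg1. Qed.
Lemma ppc_mulV : left_inverse (ppc_of 1) ppc_inv ppc_mul.
Proof. by move=> u; apply/ppcP => N; exact: mulVg. Qed.
Lemma ppc_mulVr : right_inverse (ppc_of 1) ppc_inv ppc_mul.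
Proof. by move=> u; apply/ppcP => N; exact: mulgV. Qed.

HB.instance Definition _ := isGroup.Build pro_p_completion
  ppc_mulA ppc_mul1 ppc_mulr1 ppc_mulV ppc_mulVr.

Lemma ppc_at_near (w : pro_p_completion) (N : pnormal) :
  nbhs w [set u | ppc_at u N = ppc_at w N].
Proof.
pose W := prod_topology (fun N : pnormal => discrete_topology (quotg N)).
have cN : continuous (fun f : W => f N).
  move=> f; have /cvg_sup/(_ N) : f --> f by exact: cvg_id.
  move=> fN A Af; apply: fN.
  exact: (@initial_continuous W _ (fun f : W => f N) f A Af).
have wN : nbhs (val w N) [set val w N].
  exact: (@discrete_set1 (discrete_topology (quotg N))).
exact: (@initial_continuous (coherent : Type) W set_val w _ (cN _ _ wN)).
Qed.

Lemma ppc_continuous (X : topologicalType) (f : X -> pro_p_completion) :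
  (forall x N, nbhs x [set y | ppc_at (f y) N = ppc_at (f x) N]) ->
  continuous f.
Proof.
move=> cf; apply: continuous_comp_initial => x; apply/cvg_sup => N.
move: x; apply: continuous_comp_initial => x A /principal_filterP Ax.
apply: filterS (cf x N) => y /= yx.
by change (A (ppc_at (f y) N)); rewrite yx.
Qed.

Lemma ppc_mul_continuous :
  continuous (fun uv : pro_p_completion * pro_p_completion => uv.1 * uv.2).
Proof.
apply: ppc_continuous => -[u v] N.
exists ([set u' | ppc_at u' N = ppc_at u N], [set v' | ppc_at v' N = ppc_at v N]).
  by split; exact: ppc_at_near.
by move=> -[u' v'] [/= uu' vv']; rewrite /ppc_at /= uu' vv'.
Qed.

Lemma ppc_inv_continuous : continuous (fun u : pro_p_completion => u^-1).
Proof.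
apply: ppc_continuous => u N; apply: filterS (ppc_at_near u N) => v /= uv.
by rewrite /ppc_at /= uv.
Qed.

HB.instance Definition _ := isTopologicalGroup.Build pro_p_completion
  ppc_mul_continuous ppc_inv_continuous.
End ProPCompletion.

Section TopologicalQuotient.
Variables (G : topologicalGroupType) (N : normal_subgroup G).

Definition topquotg := quotient_topology (quotg N).
HB.instance Definition _ := Quotient.on topquotg.
HB.instance Definition _ := Topological.on topquotg.
HB.instance Definition _ := isGroup.Build topquotg
  (@quotg_mulA G N) (@quotg_mul1 G N) (@quotg_mulr1 G N)
  (@quotg_mulV G N) (@quotg_mulVr G N).

Lemma pi_nbhs (x : G) (V : set G) :
  nbhs x V -> nbhs (\pi_topquotg x) [set \pi_topquotg y | y in V].
Proof.
rewrite nbhsE => -[U [oU Ux] UV].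
apply: (@filterS _ _ _ [set \pi_topquotg y | y in U]).
  by move=> _ [y Uy <-]; exists y => //; exact: UV.
apply: open_nbhs_nbhs; split; last by exists x.
suff : @open G (\pi_topquotg @^-1` [set \pi_topquotg y | y in U]) by [].
rewrite openE => z [y Uy yz].
have Uz : nbhs (z * (z^-1 * y)) U.
  by rewrite mulgA mulgV mul1g; exact: open_nbhs_nbhs.
have [[V1 V2] [/= zV1 V2y] V12U] := mulg_continuous (z, z^-1 * y) _ Uz.
rewrite /interior; apply: filterS zV1 => t V1t /=; exists (t * (z^-1 * y)).
  by apply: (V12U (_, _)); split => //=; exact: nbhs_singleton.
apply/esym/quotgP; rewrite mulgA mulVg mul1g; apply/quotgP; exact: esym.
Qed.

Lemma topquotg_mul_continuous :
  continuous (fun ab : topquotg * topquotg => ab.1 * ab.2).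
Proof.
move=> -[a b]; elim/quotW: a => x; elim/quotW: b => y U /=.
rewrite [_ * _]quotg_mul_pi => /(@pi_continuous G (quotg N) (x * y)) Uxy.
have [[V1 V2] [/= xV1 yV2] V12] := mulg_continuous (x, y) _ Uxy.
exists ([set \pi_topquotg z | z in V1], [set \pi_topquotg z | z in V2]).
  by split; exact: pi_nbhs.
move=> _ [/= [x' V1x' <-] [y' V2y' <-]].
by rewrite /= [_ * _]quotg_mul_pi; exact: (V12 (x', y')).
Qed.

Lemma topquotg_inv_continuous : continuous (fun a : topquotg => a^-1).
Proof.
apply/quotient_continuous => x U /=.
rewrite [_^-1]quotg_inv_pi => /(@pi_continuous G (quotg N)) /invg_continuous Ux.
have {}Ux : nbhs x [set y | U (\pi_topquotg y^-1)] by [].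
by apply: filterS Ux => y /=; rewrite -[\pi_topquotg _](@quotg_inv_pi G N).
Qed.

HB.instance Definition _ := isTopologicalGroup.Build topquotg
  topquotg_mul_continuous topquotg_inv_continuous.
End TopologicalQuotient.

Section ClosedNormalClosure.
Variables (G : topologicalGroupType) (A : set G).

Definition closed_normal_closure_set : set G :=
  [set x | forall M : normal_subgroup G,
    closed (M : set G) -> A `<=` M -> ns_set M x].

Lemma closed_normal_closure1 : closed_normal_closure_set 1.
Proof. by move=> M _ _; exact: ns1. Qed.
Lemma closed_normal_closureM x y : closed_normal_closure_set x ->
  closed_normal_closure_set y -> closed_normal_closure_set (x * y).
Proof. by move=> cx cy M cM AM; apply: nsM; [exact: cx|exact: cy]. Qed.
Lemma closed_normal_closureV x :
  closed_normal_closure_set x -> closed_normal_closure_set x^-1.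
Proof. by move=> cx M cM AM; apply: nsV; exact: cx. Qed.
Lemma closed_normal_closureJ x y :
  closed_normal_closure_set x -> closed_normal_closure_set (x ^ y).
Proof. by move=> cx M cM AM; apply: nsJ; exact: cx. Qed.

Definition closed_normal_closure : normal_subgroup G :=
  NormalSubgroup closed_normal_closure1 closed_normal_closureM
    closed_normal_closureV closed_normal_closureJ.
End ClosedNormalClosure.

(* For a finite set X the pro-p completion of the free group on X is the free *)
(* pro-p group on X.                                                          *)
Definition free_pro_p (p : nat) (X : finType) := pro_p_completion p (free_group X).
HB.instance Definition _ (p : nat) (X : finType) :=
  TopologicalGroup.on (free_pro_p p X).

Definition free_pro_p_gen (p : nat) (X : finType) (x : X) : free_pro_p p X :=
  ppc_of p (fg_gen x).

(* r = None is the level oo, with p ^ oo = 0. *)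
Definition ppow (p : nat) (r : option nat) : nat :=
  if r is Some k then (p ^ k)%N else 0%N.

Section Demushkin.
Variables (p : nat) (r : option nat) (n : nat) (n_gt0 : (0 < n)%N).

Local Notation F := (free_pro_p p ('I_n + 'I_n)%type).

Definition dem_x (i : 'I_n) : F := free_pro_p_gen p (inl i).
Definition dem_y (i : 'I_n) : F := free_pro_p_gen p (inr i).

(* Indices are shifted: Ordinal n_gt0 is the index of x_1. The commutator is  *)
(* [~ x, y] = x^-1 y^-1 x y.                                                  *)
Definition demushkin_relator : F :=
  dem_x (Ordinal n_gt0) ^+ ppow p r * \prod_(i < n) [~ dem_x i, dem_y i].

Definition demushkin := topquotg (closed_normal_closure [set demushkin_relator]).
HB.instance Definition _ := TopologicalGroup.on demushkin.
End Demushkin.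

Definition contHom (G : topologicalGroupType) (H : finGroupType) : set (G -> H) :=
  [set f : G -> H | {morph f : x y / x * y} /\
                    continuous (f : G -> discrete_topology H)].
Arguments contHom : clear implicits.

Definition expgz (G : groupType) (g : G) (z : int) : G :=
  match z with Posz k => g ^+ k | Negz k => g ^- k.+1 end.

(* Main.v *)
Require Import Defs.
From HB Require Import structures.
From mathcomp Require Import all_boot all_order all_algebra.
From mathcomp Require Import all_fingroup all_solvable all_field all_character.
From mathcomp Require Import generic_quotient finmap.
From mathcomp Require Import boolp classical_sets functions cardinality.
From mathcomp Require Import topology.
From mathcomp Require Import ring.

(**
  Write [G] for the Demushkin group. Any map from the generators to the finite
  [p]-group [Gamma] extends to the discrete free group; its kernel has
  [p]-power index, so the extension factors continuously through the pro-[p]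
  completion, and it descends to [G] as soon as it kills the relator. Since the
  discrete free group is dense in its completion (the normal subgroups of
  [p]-power index are closed under intersection), a continuous morphism is
  determined by its values on the generators. Hence [Hom(G, Gamma)] is in
  bijection with the solutions of [x_1^(p^r) [x_1, y_1] ... [x_n, y_n] = 1] in
  [Gamma^(2n)], which are counted by the Frobenius method: [g = 1] is detected
  by the regular character [sum_chi chi(1) chi(g)], and
  [sum_y chi(h g^y) = |Gamma| / chi(1) * chi(h) chi(g)] removes the
  commutators one at a time.
*)

Set Implicit Arguments.
Unset Strict Implicit.
Unset Printing Implicit Defensive.

Section ContinuousMorphisms.
Local Open Scope classical_set_scope.
Local Open Scope group_scope.
Local Open Scope quotient_scope.
Local Open Scope card_scope.

Lemma morph_mulg1 (G H : groupType) (f : G -> H) :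
  {morph f : x y / x * y} -> f 1 = 1.
Proof. by move=> fM; apply: (mulgI (f 1)); rewrite -fM !mulg1. Qed.

Definition group_morphism_of (G H : groupType) (f : G -> H)
    (fM : {morph f : x y / x * y}) : UMagmaMorphism.type G H :=
  HB.pack f (isMultiplicative.Build _ _ f fM)
    (Multiplicative_isUMagmaMorphism.Build _ _ f (morph_mulg1 fM)).

(** * Evaluation of words of the free group *)

Section FreeGroupEval.
Variables (X : choiceType) (H : groupType).

Definition letter_eval (f : X -> H) (a : X * bool) : H :=
  if a.2 then (f a.1)^-1 else f a.1.

Definition fg_eval (f : X -> H) (u : free_group X) : H :=
  foldr (fun a => mulg (letter_eval f a)) 1 (word u).

Lemma foldr_letter_eval_push f a w :
  foldr (fun a => mulg (letter_eval f a)) 1 (push a w) =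
    letter_eval f a * foldr (fun a => mulg (letter_eval f a)) 1 w.
Proof.
case: w => //= b w; case: eqP => //= ->.
rewrite mulgA; case: a => x [] /=; rewrite /letter_eval /=.
  by rewrite mulVg mul1g.
by rewrite mulgV mul1g.
Qed.

Lemma fg_evalM f : {morph fg_eval f : u v / u * v}.
Proof.
move=> u v; rewrite /fg_eval /=; elim: (word u) => [|a w IHw] /=.
  by rewrite mul1g.
by rewrite foldr_letter_eval_push IHw mulgA.
Qed.

Lemma fg_eval_gen f x : fg_eval f (fg_gen x) = f x.
Proof. by rewrite /fg_eval /= mulg1. Qed.

Lemma fg_morphism_eq (f g : UMagmaMorphism.type (free_group X) H) :
  (forall x, f (fg_gen x) = g (fg_gen x)) -> f =1 g.
Proof.
move=> fg [w]; elim: w => [|a w IHw] rw.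
  have -> : FreeGroup rw = 1 by apply: val_inj.
  by rewrite !gmulf1.
have rw' : reduced w by exact: path_sorted rw.
pose s := if a.2 then (fg_gen a.1)^-1 else fg_gen a.1.
(* The word is reduced, so [push] meets no cancellation and simply prepends the letter. *)
have -> : FreeGroup rw = s * FreeGroup rw'.
  apply: val_inj; rewrite /s; case: a rw {s} => x [] rw /=.
    by case: w rw {IHw rw'} => //= b w; rewrite /reduced /= => /andP[/negPf->].
  by case: w rw {IHw rw'} => //= b w; rewrite /reduced /= => /andP[/negPf->].
by rewrite !gmulfM IHw /s; case: a.2; rewrite ?gmulfV fg.
Qed.
End FreeGroupEval.

(** * Kernels and induced maps on quotients *)

Section Kernel.
Variables (G H : groupType) (f : UMagmaMorphism.type G H).

Lemma kernel_ns1 : [set x | f x = 1] 1. Proof. exact: gmulf1. Qed.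
Lemma kernel_nsM x y : [set x | f x = 1] x -> [set x | f x = 1] y ->
  [set x | f x = 1] (x * y).
Proof. by rewrite /= gmulfM => -> ->; rewrite mulg1. Qed.
Lemma kernel_nsV x : [set x | f x = 1] x -> [set x | f x = 1] x^-1.
Proof. by rewrite /= gmulfV => ->; rewrite invg1. Qed.
Lemma kernel_nsJ x y : [set x | f x = 1] x -> [set x | f x = 1] (x ^ y).
Proof. by rewrite /= gmulfJ => ->; rewrite conj1g. Qed.

Definition kernel_ns : normal_subgroup G :=
  NormalSubgroup kernel_ns1 kernel_nsM kernel_nsV kernel_nsJ.

Lemma kernel_nsP x y : ns_set kernel_ns (x^-1 * y) <-> f x = f y.
Proof.
rewrite /= gmulfM gmulfV; split=> [/(canRL (mulKVg _))|->]; last exact: mulVg.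
by rewrite mulg1.
Qed.

(* Independent of the representative only when [N] is contained in the kernel
   of [f]. *)
Definition quotg_morph (N : normal_subgroup G) (a : quotg N) : H := f (repr a).

Section QuotgMorph.
Variables (N : normal_subgroup G) (Nker : N `<=` kernel_ns).

Lemma quotg_morph_pi x : quotg_morph (\pi_(quotg N) x) = f x.
Proof. by apply/kernel_nsP/Nker/quotgP; rewrite reprK. Qed.

Lemma quotg_morphM : {morph @quotg_morph N : a b / a * b}.
Proof.
move=> a b; elim/quotW: a => x; elim/quotW: b => y.
by rewrite [_ * _]quotg_mul_pi !quotg_morph_pi gmulfM.
Qed.
End QuotgMorph.
End Kernel.

Lemma card_eq_finset (T : finType) (A : {set T}) : [set` A] #= `I_#|A|.
Proof.
have -> : [set` A] = @enum_val T (mem A) @` [set: 'I_#|A|].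
  apply/seteqP; split=> [x /= Ax|_ [k _ <-]]; last exact: enum_valP.
  by exists (enum_rank_in Ax x) => //; rewrite enum_rankK_in.
apply: card_eq_trans (card_esym card_II).
exact: inj_card_eq (in2W enum_val_inj).
Qed.

(** * Extension of morphisms to the pro-[p] completion *)

Section PKernel.
Variables (p : nat) (G : groupType) (H : finGroupType).
Variables (f : UMagmaMorphism.type G H) (pH : p.-group [set: H]%G).

(** The quotient by the kernel is in bijection with the image of [f], a subgroup of the [p]-group
    [H]. *)
Lemma kernel_pnormal_subproof :
  exists k : nat, [set: quotg (kernel_ns f)] #= `I_(p ^ k)%N.
Proof.
pose A := [set h | `[< exists x, f x = h >]]%SET.
have AP h : reflect (exists x, f x = h) (h \in A).
  by rewrite finset.inE; exact: asboolP.
have gA : group_set A.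
  apply/group_setP; split; first by apply/AP; exists 1; exact: gmulf1.
  move=> _ _ /AP[x <-] /AP[y <-]; apply/AP.
  by exists (x * y); exact: gmulfM.
have [k Ak] := p_natP (pgroupS (finset.subsetT (Group gA)) pH).
exists k; rewrite -Ak; apply: card_eq_trans (card_eq_finset _).
have -> : [set` (Group gA)] = @quotg_morph _ _ f (kernel_ns f) @` setT.
  apply/seteqP; split=> [h|_ [a _ <-]] /=.
    move=> /AP[x <-]; exists (\pi_(quotg (kernel_ns f)) x) => //.
    exact: quotg_morph_pi.
  by apply/AP; exists (repr a).
apply: card_esym; apply: inj_card_eq; apply: in2W => a b.
elim/quotW: a => x; elim/quotW: b => y; rewrite !quotg_morph_pi //.
by move=> fxy; apply/quotgP/kernel_nsP.
Qed.

Definition kernel_pnormal : pnormal p G := PNormal kernel_pnormal_subproof.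

(** Only the coordinate at the kernel of [f] is read; since coordinates are locally constant, this
    makes the extension continuous. *)
Definition ppc_morph (w : pro_p_completion p G) : H :=
  quotg_morph f (ppc_at w kernel_pnormal).

Lemma ppc_morph_of g : ppc_morph (ppc_of p g) = f g.
Proof. exact: quotg_morph_pi. Qed.

Lemma ppc_morphM : {morph ppc_morph : u v / u * v}.
Proof. by move=> u v; rewrite /ppc_morph -quotg_morphM. Qed.

Lemma ppc_morph_continuous :
  continuous (ppc_morph : pro_p_completion p G -> discrete_topology H).
Proof.
move=> w A /principal_filterP Aw.
apply: filterS (ppc_at_near w kernel_pnormal) => u /= uw.
by change (A (ppc_morph u)); rewrite /ppc_morph uw.
Qed.
End PKernel.

(** * Transport of a group law to a finite type *)

Section TransportedGroup.
Variables (T : groupType) (U : finType) (e : T -> U) (d : U -> T).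

(** The alias takes [eK] and [dK] as arguments so that the group instance declared on it can depend
    on them. *)
Definition transported (eK : cancel e d) (dK : cancel d e) : Type := U.

Variables (eK : cancel e d) (dK : cancel d e).
Local Notation V := (transported eK dK).

HB.instance Definition _ := Finite.copy V U.

Definition transported_mul (a b : V) : V := e (d a * d b).
Definition transported_inv (a : V) : V := e (d a)^-1.

Lemma transported_mulA : associative transported_mul.
Proof. by move=> a b c; rewrite /transported_mul !eK mulgA. Qed.
Lemma transported_mul1 : left_id (e 1 : V) transported_mul.
Proof. by move=> a; rewrite /transported_mul eK mul1g dK. Qed.
Lemma transported_mulV : left_inverse (e 1 : V) transported_inv transported_mul.
Proof. by move=> a; rewrite /transported_mul eK mulVg. Qed.

HB.instance Definition _ := Finite_isGroup.Build V
  transported_mulA transported_mul1 transported_mulV.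

Lemma transportM : {morph (e : T -> V) : x y / x * y}.
Proof.
by move=> x y; change (e (x * y) = e (d (e x) * d (e y))); rewrite !eK.
Qed.
End TransportedGroup.

(** * Normal subgroups of [p]-power index and density *)

Section PNormal.
Variables (p : nat) (p_prime : prime p) (G : groupType).

(** Numbering the cosets by ['I_(p ^ k)] and transporting the quotient law there gives the finite
    group [H], with the projection as [f]. *)
Lemma pnormal_is_ker (N : pnormal p G) :
  exists (H : finGroupType) (f : UMagmaMorphism.type G H),
    p.-group [set: H]%G /\ ns_set N = [set x | f x = 1].
Proof.
have [k /card_set_bijP[f [fk finj fsurj]]] := pnP N.
pose e a : 'I_(p ^ k) := Ordinal (fk a I).
have e_surj j : exists a, e a = j.
  by have [a _ aj] := fsurj j (ltn_ord j); exists a; apply: val_inj.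
have [d dK] := choice e_surj.
have eK : cancel e d.
  by move=> a; apply: finj; rewrite ?inE //; have /(congr1 val) := dK (e a).
pose H : finGroupType := transported eK dK.
have gM : {morph (fun x => e (\pi_(quotg N) x) : H) : x y / x * y}.
  by move=> x y; rewrite -[RHS]transportM [\pi_(quotg N) x * _]quotg_mul_pi.
exists H, (group_morphism_of gM); split.
  by rewrite /pgroup cardsT card_ord pnatX pnat_id //.
have gE x : (e (\pi_(quotg N) x) = 1 :> H) <-> ns_set N x.
  split=> [|Nx].
    by move=> /(can_inj eK) /esym/quotgP; rewrite invg1 mul1g.
  by congr (e _); apply/esym/quotgP; rewrite invg1 mul1g.
by apply/seteqP; split=> x /=; have [] := gE x.
Qed.

(** If [N] and [M] are kernels of maps to [p]-groups, [K] is the kernel of the paired map to their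
    direct product. *)
Lemma pnormalI (N M : pnormal p G) :
  exists K : pnormal p G, K `<=` N /\ K `<=` M.
Proof.
have [H1 [f1 [pH1 ->]]] := pnormal_is_ker N.
have [H2 [f2 [pH2 ->]]] := pnormal_is_ker M.
pose f x : H1 * H2 := (f1 x, f2 x).
have fM : {morph f : x y / x * y} by move=> x y; rewrite /f !gmulfM.
have pH : p.-group [set: H1 * H2]%G.
  by rewrite /pgroup cardsT card_prod pnatM -!cardsT; apply/andP.
exists (@kernel_pnormal p G _ (group_morphism_of fM) pH).
by split=> x /= [].
Qed.

(** Ensures that the filter base in [ppc_nbhs_basis] is nonempty. *)
Lemma pnormal_inhabited : inhabited (pnormal p G).
Proof.
have fM : {morph (fun _ : G => 1 : 'I_1) : x y / x * y}.
  by move=> x y; rewrite mulg1.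
have p1 : p.-group [set: 'I_1]%G by rewrite /pgroup cardsT card_ord.
exact: inhabits (kernel_pnormal (group_morphism_of fM) p1).
Qed.

Lemma cvg_initial (S : choiceType) (T : topologicalType) (f : S -> T)
    (F : set_system S) (s : S) : Filter F ->
  f @ F --> f s -> F --> (s : initial_topology f).
Proof.
move=> FF fF A; rewrite nbhsE => -[B [[C oC <-] Cs] BA].
by apply: filterS BA _; apply: fF; exact: open_nbhs_nbhs.
Qed.

Lemma ppc_at_proj (u : pro_p_completion p G) (N M : pnormal p G) :
  N `<=` M -> quotg_proj M (ppc_at u N) = ppc_at u M.
Proof. exact: (set_mem (valP u)). Qed.

(** The sets fixing one coordinate form a filter base by [pnormalI], and the filter they generate
    converges to [w] coordinatewise, so it contains every neighbourhood of [w]. *)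
Lemma ppc_nbhs_basis (w : pro_p_completion p G) A :
  nbhs w A -> exists N, [set u | ppc_at u N = ppc_at w N] `<=` A.
Proof.
pose B (N : pnormal p G) := [set u | ppc_at u N = ppc_at w N].
pose F := filter_from setT B.
have FF : Filter F.
  apply: filter_from_filter; first by have [N] := pnormal_inhabited; exists N.
  move=> N M _ _; have [K [KN KM]] := pnormalI N M; exists K => // u uw.
  by split; rewrite /B /= -(ppc_at_proj u KN, ppc_at_proj u KM)
    -(ppc_at_proj w KN, ppc_at_proj w KM) uw.
have cF : F --> w.
  apply: cvg_initial; apply/cvg_sup => N; apply: cvg_initial.
  move=> C /principal_filterP Cw; exists N => // u uw.
  by change (C (ppc_at u N)); rewrite uw.
by move=> /cF[N _ NA]; exists N.
Qed.

Lemma ppc_continuous_eq (H : choiceType) (f g : pro_p_completion p G -> H) :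
  continuous (f : _ -> discrete_topology H) ->
  continuous (g : _ -> discrete_topology H) ->
  (forall x, f (ppc_of p x) = g (ppc_of p x)) -> f =1 g.
Proof.
move=> cf cg fg w.
have cst (h : pro_p_completion p G -> H) :
    continuous (h : _ -> discrete_topology H) -> nbhs w [set u | h u = h w].
  move=> ch; apply: (ch w [set h w]).
  exact: (@discrete_set1 (discrete_topology H)).
have [N NA] := ppc_nbhs_basis (filterI (cst f cf) (cst g cg)).
(* Density: a representative of the coordinate of [w] at [N] is an element of [G] in a neighbourhood
   where both maps are constant. *)
have /NA[<- <-] : ppc_at (ppc_of p (repr (ppc_at w N))) N = ppc_at w N.
  exact: reprK.
exact: fg.
Qed.
End PNormal.

(** * Descent to the quotient by a closed normal closure *)

Section TopologicalQuotientMorphism.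
Variables (G : topologicalGroupType) (H : finGroupType) (A : set G).
Variable f : UMagmaMorphism.type G H.
Hypothesis cf : continuous (f : G -> discrete_topology H).
Hypothesis fA : forall x, A x -> f x = 1.

(** The kernel is closed, being the preimage of a point of a discrete space, so it is one of the
    subgroups being intersected. *)
Lemma closed_normal_closure_sub_ker : closed_normal_closure A `<=` kernel_ns f.
Proof.
move=> x; apply => //; have := @discrete_closed (discrete_topology H) [set 1].
by apply: preimage_closed => y _; exact: cf.
Qed.

Lemma contHom_quotg_morph :
  contHom (topquotg (closed_normal_closure A)) H
    (quotg_morph f (N := closed_normal_closure A)).
Proof.
split; first exact: quotg_morphM closed_normal_closure_sub_ker.
apply/quotient_continuous => x B /= fB.
have {}fB : nbhs (f x : discrete_topology H) B.
  move: fB; rewrite /= quotg_morph_pi //.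
  exact: closed_normal_closure_sub_ker.
have {}fB : nbhs x [set y | B (f y)] by exact: cf.
apply: filterS fB => y /= By.
by rewrite quotg_morph_pi //; exact: closed_normal_closure_sub_ker.
Qed.
End TopologicalQuotientMorphism.

(** * Homomorphisms as solutions of the relator equation *)

Section DemushkinHom.
Variables (p n : nat) (r : option nat) (H : finGroupType).
Hypotheses (p_prime : prime p) (n_gt0 : (0 < n)%N) (pH : p.-group [set: H]%G).

Local Notation D := (demushkin p r n_gt0).
Local Notation F := (free_pro_p p ('I_n + 'I_n)%type).
Local Notation relN :=
  (closed_normal_closure [set demushkin_relator p r n_gt0]).
Local Notation piD := (\pi_(topquotg relN)).

Definition demushkin_solutions : {set {ffun 'I_n -> H * H}} :=
  [set f : {ffun 'I_n -> H * H} | (f (Ordinal n_gt0)).1 ^+ ppow p r *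
           \prod_(k < n) [~ (f k).1, (f k).2] == 1]%SET.

Definition gen_values (h : D -> H) : {ffun 'I_n -> H * H} :=
  [ffun k => (h (piD (dem_x p k)), h (piD (dem_y p k)))].

Lemma demushkin_piM x y : piD (x * y) = piD x * piD y :> D.
Proof. by rewrite [RHS]quotg_mul_pi. Qed.

Lemma gen_values_solution h :
  contHom D H h -> gen_values h \in demushkin_solutions.
Proof.
move=> [hM _]; rewrite finset.inE; apply/eqP.
have hpiM : {morph (fun u : F => h (piD u)) : x y / x * y}.
  by move=> x y; rewrite demushkin_piM hM.
pose hpi := group_morphism_of hpiM.
(* The relator lies in every closed normal subgroup containing it, so its class is trivial. *)
have : hpi (demushkin_relator p r n_gt0) = 1.
  rewrite -[RHS](gmulf1 (s := hpi)); congr (h _); apply/esym/quotgP.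
  by rewrite invg1 mul1g => M _; apply.
rewrite gmulfM gmulfXn gmulf_prod => relE.
rewrite -[RHS]relE ffunE; congr (_ * _).
by apply: eq_bigr => k _; rewrite ffunE gmulfR.
Qed.

Lemma gen_values_inj : {in contHom D H &, injective gen_values}.
Proof.
move=> h1 h2 /set_mem[h1M ch1] /set_mem[h2M ch2] eq_gen; apply/funext => a.
elim/quotW: a => w.
have cpi (h : D -> H) : continuous (h : D -> discrete_topology H) ->
    continuous ((fun u : F => h (piD u)) : F -> discrete_topology H).
  by move=> ch; apply/quotient_continuous.
apply: (ppc_continuous_eq p_prime (cpi _ ch1) (cpi _ ch2)) => g /=.
have hM (h : D -> H) : {morph h : x y / x * y} ->
    {morph (fun g => h (piD (ppc_of p g))) : x y / x * y}.
  move=> hM x y; rewrite -hM -demushkin_piM; congr (h (piD _)).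
  by apply/ppcP => N; rewrite [RHS]quotg_mul_pi.
apply: (@fg_morphism_eq _ _ (group_morphism_of (hM _ h1M))
  (group_morphism_of (hM _ h2M))) => -[] k /=.
  by have /ffunP/(_ k) := eq_gen; rewrite !ffunE => -[].
by have /ffunP/(_ k) := eq_gen; rewrite !ffunE => -[].
Qed.

Lemma gen_values_surj f : f \in demushkin_solutions ->
  exists2 h, contHom D H h & gen_values h = f.
Proof.
rewrite finset.inE => /eqP fS.
pose v (s : 'I_n + 'I_n) :=
  match s with inl k => (f k).1 | inr k => (f k).2 end.
pose e := group_morphism_of (@fg_evalM _ _ v).
pose E : UMagmaMorphism.type F H := group_morphism_of (ppc_morphM e pH).
have cE : continuous (E : F -> discrete_topology H).
  exact: ppc_morph_continuous.
have E_gen s : E (free_pro_p_gen p s) = v s.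
  by rewrite [LHS]ppc_morph_of [LHS]fg_eval_gen.
have Erel x : [set demushkin_relator p r n_gt0] x -> E x = 1.
  move=> ->; rewrite gmulfM gmulfXn gmulf_prod -[RHS]fS E_gen; congr (_ * _).
  by apply: eq_bigr => k _; rewrite gmulfR !E_gen.
exists (quotg_morph E (N := relN)).
  exact: (@contHom_quotg_morph F H [set demushkin_relator p r n_gt0] E cE Erel).
apply/ffunP => k; rewrite ffunE.
have EE x : quotg_morph E (piD x) = E x.
  by apply: quotg_morph_pi; exact: closed_normal_closure_sub_ker cE Erel.
by rewrite !EE !E_gen /v -surjective_pairing.
Qed.

Lemma card_contHom_demushkin : contHom D H #= `I_#|demushkin_solutions|.
Proof.
apply: card_eq_trans (card_eq_finset _).
rewrite card_eq_sym.
rewrite -(_ : gen_values @` contHom D H = [set` demushkin_solutions]).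
  exact: inj_card_eq gen_values_inj.
apply/seteqP; split=> [_ [h hh <-]|f /gen_values_surj[h hh <-]].
  exact: gen_values_solution.
by exists h.
Qed.
End DemushkinHom.
End ContinuousMorphisms.

Import GRing.Theory.
Local Open Scope ring_scope.

(** * Character sums over conjugates and commutators *)

Section CharacterSums.
Variables (gT : finGroupType) (G : {group gT}).
Implicit Types i : Iirr G.

Lemma sum_irrM_irrV i j y :
  \sum_(x in G) 'chi_i (x * y)%g * 'chi_j x^-1%g =
    (i == j)%:R * (#|G|%:R / 'chi_i 1%g * 'chi_i y).
Proof.
have /(canRL (mulVKf (neq0CG G))) -> :=
  generalized_orthogonality_relation y i j.
by rewrite mulrCA; congr (_ * _); rewrite mulrCA mulrC.
Qed.

(** Packages the sum as a class function, to be expanded in irreducible characters. Invariance under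
    [z] comes from substituting [y * z] for [y]; the factor [h \in G] forces vanishing off [G]. *)
Fact sum_irr_conj_subproof i (g : gT) :
  is_class_fun <<G>>%g
    [ffun h => (\sum_(y in G) 'chi_i (h * g ^ y)%g) *+ (h \in G)].
Proof.
rewrite genGid; apply: intro_class_fun => [h z Gh Gz|h /negPf->]; last by [].
rewrite groupJr //; congr (_ *+ _).
rewrite (reindex_inj (mulIg z)); apply: eq_big => [y|y Gy].
  by rewrite /= groupMr.
by rewrite conjgM -conjMg cfunJ.
Qed.

(* The left-hand side is a class function of [h]; its inner products with the
   irreducible characters are given by the orthogonality relations. *)
Lemma sum_irr_conj i g h : g \in G -> h \in G ->
  \sum_(y in G) 'chi_i (h * g ^ y)%g =
    #|G|%:R / 'chi_i 1%g * ('chi_i h * 'chi_i g).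
Proof.
move=> Gg Gh; pose F := Cfun 0 (sum_irr_conj_subproof i g).
have dotF j :
    '[F, 'chi_j] = (i == j)%:R * (#|G|%:R / 'chi_i 1%g * 'chi_i g).
  rewrite cfdotE; apply: (canLR (mulKf (neq0CG G))).
  transitivity
    (\sum_(y in G) \sum_(x in G) 'chi_i (x * g ^ y)%g * 'chi_j x^-1%g).
    rewrite exchange_big; apply: eq_bigr => x Gx /=.
    by rewrite cfunE Gx mulr1n irr_inv mulr_suml.
  under eq_bigr => y Gy do rewrite sum_irrM_irrV cfunJ //.
  by rewrite sumr_const -[LHS]mulr_natl.
have -> : \sum_(y in G) 'chi_i (h * g ^ y)%g = F h by rewrite cfunE Gh.
rewrite [F]cfun_sum_cfdot sum_cfunE (bigD1 i) //= big1 ?addr0 => [|j nij].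
  by rewrite cfunE dotF eqxx mul1r -[LHS]mulrA; congr (_ * _); exact: mulrC.
by rewrite cfunE dotF eq_sym (negPf nij) !mul0r.
Qed.

(** As [[~ x, y]] is [x^-1 * x ^ y], the sum over [y] is an instance of [sum_irr_conj]; the sum over
    [x] is then a convolution of ['chi_i] with itself, giving the second factor. *)
Lemma sum_irr_commg i h : h \in G ->
  \sum_(x in G) \sum_(y in G) 'chi_i (h * [~ x, y])%g =
    (#|G|%:R / 'chi_i 1%g) ^+ 2 * 'chi_i h.
Proof.
move=> Gh; set c := _ / _.
have cE x : x \in G ->
    \sum_(y in G) 'chi_i (h * [~ x, y])%g =
      c * ('chi_i (h * x^-1)%g * 'chi_i x).
  move=> Gx; rewrite -sum_irr_conj ?groupM ?groupV //.
  by apply: eq_bigr => y _; rewrite mulgA.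
rewrite (eq_bigr _ cE) -mulr_sumr expr2 -mulrA; congr (_ * _).
have := sum_irrM_irrV i i h; rewrite eqxx mul1r => <-.
(* After [x] is replaced by its inverse, conjugation by [x^-1] turns [h * x] into [x * h]. *)
rewrite (reindex_inj invg_inj); apply: eq_big => [x|x Gx]; first exact: groupV.
by rewrite invgK -['chi_i (h * x)%g](cfunJ _ _ Gx) conjgE invgK mulgK.
Qed.

(** Only the sum over [y] can be evaluated, since [x] also occurs in the power; the remaining sum is
    the inner sum of the final formula. *)
Lemma sum_irr_expg_commg i q :
  \sum_(x in G) \sum_(y in G) 'chi_i (x ^+ q * [~ x, y])%g =
    #|G|%:R / 'chi_i 1%g *
    \sum_(x in G) 'chi_i (x ^+ q * x^-1)%g * 'chi_i x.
Proof.
rewrite mulr_sumr; apply: eq_bigr => x Gx.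
rewrite -sum_irr_conj ?groupM ?groupV ?groupX //.
by apply: eq_bigr => y _; rewrite mulgA.
Qed.

Lemma sum_irr1_irr g :
  \sum_(i : Iirr G) 'chi_i 1%g * 'chi_i g = #|G|%:R *+ (g == 1%g).
Proof.
by rewrite -cfRegE cfReg_sum sum_cfunE; apply: eq_bigr => i _; rewrite cfunE.
Qed.
End CharacterSums.

(** * Counting solutions one commutator at a time *)

Lemma sum_ffun_ordS (R : nmodType) (T : finType) n
    (F : {ffun 'I_n.+1 -> T} -> R) :
  \sum_f F f =
    \sum_a \sum_(f : {ffun 'I_n -> T})
      F [ffun k => if unlift ord0 k is Some j then f j else a].
Proof.
rewrite pair_bigA /=.
rewrite (reindex
  (fun u : T * {ffun 'I_n -> T} =>
     [ffun k => if unlift ord0 k is Some j then u.2 j else u.1])) //=.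
exists (fun f => (f ord0, [ffun j => f (lift ord0 j)])) => [[a f] _|f _].
  rewrite ffunE unlift_none; congr (_, _); apply/ffunP => j.
  by rewrite !ffunE liftK.
by apply/ffunP => k; rewrite ffunE; case: unliftP => [j|] ->; rewrite ?ffunE.
Qed.

(** [F] receives the first pair separately because its first entry also enters the power in the
    relator. *)
Lemma sum_prod_commg_ordS (R : nmodType) (gT : finGroupType) n
    (F : gT * gT -> gT -> R) :
  \sum_(f : {ffun 'I_n.+1 -> gT * gT})
      F (f ord0) (\prod_(k < n.+1) [~ (f k).1, (f k).2])%g =
    \sum_a \sum_(f : {ffun 'I_n -> gT * gT})
      F a ([~ a.1, a.2] * \prod_(k < n) [~ (f k).1, (f k).2])%g.
Proof.
rewrite sum_ffun_ordS; apply: eq_bigr => a _; apply: eq_bigr => f _.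
rewrite big_ord_recl !ffunE unlift_none; congr (F a (_ * _)%g).
by apply: eq_bigr => k _; rewrite ffunE liftK.
Qed.

Lemma sum_irr_prod_commg (gT : finGroupType) (i : Iirr [set: gT]%G) n h :
  \sum_(f : {ffun 'I_n -> gT * gT})
      'chi_i (h * \prod_(k < n) [~ (f k).1, (f k).2])%g =
    (#|gT|%:R / 'chi_i 1%g) ^+ (2 * n) * 'chi_i h.
Proof.
elim: n h => [|n IHn] h.
  under eq_bigr => f _ do rewrite big_ord0 mulg1.
  by rewrite sumr_const card_ffun card_ord expn0 mulr1n mul1r.
rewrite (sum_prod_commg_ordS _ (fun _ g => 'chi_i (h * g)%g)).
transitivity (\sum_(a : gT * gT)
    (#|gT|%:R / 'chi_i 1%g) ^+ (2 * n) * 'chi_i (h * [~ a.1, a.2])%g).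
  by apply: eq_bigr => a _; rewrite -IHn; apply: eq_bigr => f _; rewrite mulgA.
rewrite -mulr_sumr mulnS addnC exprD -mulrA; congr (_ * _).
have := sum_irr_commg i (finset.in_setT h); rewrite cardsT => <-.
rewrite -(pair_bigA _ (fun x y => 'chi_i (h * [~ x, y])%g)) /=.
by apply: eq_big => [x|x _]; [rewrite inE|apply: eq_bigl => y; rewrite inE].
Qed.

Lemma card_expg_prod_commg (gT : finGroupType) n q :
  #|[set f : {ffun 'I_n.+1 -> gT * gT} |
      (f ord0).1 ^+ q * \prod_(k < n.+1) [~ (f k).1, (f k).2] == 1]%g|%:R =
    #|gT|%:R ^+ (2 * n) *
    \sum_(i : Iirr [set: gT]%G) ('chi_i 1%g ^+ (2 * n))^-1 *
      \sum_(x : gT) 'chi_i (x ^+ q * x^-1)%g * 'chi_i x :> algC.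
Proof.
have G_neq0 : #|gT|%:R != 0 :> algC by rewrite -cardsT neq0CG.
(* The extra factor [#|gT|] is the value at 1 of the regular character, which replaces the indicator
   of a solution. *)
apply: (mulfI G_neq0); rewrite -sum1_card natr_sum mulr_sumr.
transitivity (\sum_(f : {ffun 'I_n.+1 -> gT * gT}) \sum_(i : Iirr [set: gT]%G)
    'chi_i 1%g *
    'chi_i ((f ord0).1 ^+ q * \prod_(k < n.+1) [~ (f k).1, (f k).2])%g).
  rewrite big_mkcond /=; apply: eq_bigr => f _.
  by rewrite sum_irr1_irr cardsT inE; case: eqP; rewrite ?mulr1.
rewrite exchange_big mulrA -exprS mulr_sumr; apply: eq_bigr => i _ /=.
rewrite -mulr_sumr (sum_prod_commg_ordS _ (fun a g => 'chi_i (a.1 ^+ q * g)%g)).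
transitivity ('chi_i 1%g * \sum_(a : gT * gT)
    (#|gT|%:R / 'chi_i 1%g) ^+ (2 * n) * 'chi_i (a.1 ^+ q * [~ a.1, a.2])%g).
  congr (_ * _); apply: eq_bigr => a _; rewrite -sum_irr_prod_commg.
  by apply: eq_bigr => f _; rewrite mulgA.
rewrite -mulr_sumr -(pair_bigA _ (fun x y => 'chi_i (x ^+ q * [~ x, y])%g)) /=.
have := sum_irr_expg_commg i q; rewrite cardsT /=.
under eq_bigl => x do rewrite inE.
under eq_bigr => x _ do under eq_bigl => y do rewrite inE.
under [in RHS]eq_bigl => x do rewrite inE.
move=> ->; rewrite !mulrA; congr (_ * _).
have chi1 := irr1_neq0 i.
(* The [n] later commutators give [2 * n] factors [#|gT| / 'chi_i 1], the first pair one more; the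
   weight ['chi_i 1] cancels one denominator. *)
by rewrite expr_div_n exprSr; field; rewrite expf_neq0.
Qed.

Theorem theorem6p5 (p n : nat) (r : option nat) (Gamma : finGroupType)
    (p_prime : prime p) (p_odd : odd p) (n_gt0 : (0 < n)%N)
    (r_gt0 : r <> Some 0%N) (pGamma : (p.-group [set: Gamma]%G)%g) :
  finite_set (contHom (demushkin p r n_gt0) Gamma) /\
  (#|` fset_set (contHom (demushkin p r n_gt0) Gamma)|)%fset%:R =
    (#|Gamma| ^ (2 * n - 2))%N%:R *
    \sum_(i : Iirr [set: Gamma]%G)
      ((irr_degree (socle_of_Iirr i))%:R ^+ (2 * n - 2))^-1 *
      \sum_(g : Gamma) 'chi_i (expgz g ((ppow p r)%:Z - 1)) * 'chi_i g
    :> algC.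
Proof.
have cardD := card_contHom_demushkin r p_prime n_gt0 pGamma.
split; first by rewrite (eq_finite_set cardD); exact: finite_II.
rewrite (card_fset_set cardD) /demushkin_solutions.
case: n n_gt0 {cardD} => // m m_gt0.
rewrite (_ : Ordinal m_gt0 = ord0) ?card_expg_prod_commg; last exact: val_inj.
rewrite mulnS addKn natrX; congr (_ * _); apply: eq_bigr => i _.
rewrite irr1_degree; congr (_ * _); apply: eq_bigr => g _; congr ('chi_i _ * _).
(* The value 0 occurs at infinite level, where the exponent is -1 and [expgz] yields the inverse;
   otherwise the exponent is the natural number [q]. *)
case: ppow => [|q]; first by rewrite expg0 mul1g.
by rewrite -addn1 PoszD addrK addn1 expgSr mulgK.
Qed.
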